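(* Let $S$ be a semigroup. Then the enhanced power graph $\mathcal{P}_e(S)$ is connected if and only if $\langle x \rangle \cap \langle y \rangle \neq \varnothing$ for all $x, y \in S$. In this case, $\mathrm{diam}(\mathcal{P}_e(S)) \leq 2$.
   Context: $\mathbb{N}$ denotes the set of positive integers. For $z \in S$, $\langle z \rangle = \{z^m : m \in \mathbb{N}\}$ is the subsemigroup generated by $z$. The enhanced power graph $\mathcal{P}_e(S)$ of a semigroup $S$ is the simple undirected graph with vertex set $S$ in which two distinct vertices $x, y$ are adjacent if and only if $x, y \in \langle z \rangle$ for some $z \in S$. *)

(* Defs.v *)
From HB Require Import structures.
From mathcomp Require Import all_boot all_order all_algebra.
From mathcomp Require Import boolp classical_sets reals ereal.

Set Implicit Arguments.
Unset Strict Implicit.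
Unset Printing Implicit Defensive.

Local Open Scope classical_set_scope.

Record sgraph (V : eqType) := SGraph {
  adj :> rel V;
  adj_sym : symmetric adj;
  adj_irr : irreflexive adj
}.

Section Graph.
Variables (V : eqType) (G : sgraph V).

(* [path] alone describes walks; [uniq] makes the vertices distinct.  As in
   path.v, p omits the initial vertex x, so size p is the number of edges. *)
Definition gpath (x y : V) (p : seq V) : bool :=
  [&& path G x p, last x p == y & uniq (x :: p)].

Definition gconnected : Prop := forall x y : V, exists p, gpath x y p.

(* +oo when no path joins x to y, since then the set is empty. *)
Definition gdist (R : realType) (x y : V) : \bar R :=
  ereal_inf [set ((size p)%:R%:E)%R | p in [set p | gpath x y p]].

Definition gdiam (R : realType) : \bar R :=
  ereal_sup [set gdist R xy.1 xy.2 | xy in [set: V * V]].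

End Graph.

Section EnhancedPowerGraph.
Variable S : semigroupType.

(* z^m for m > 0.  This is [natexp] of monoid.v, which requires a unit for its
   value at 0; here the value at m = 0 is the irrelevant default z. *)
Definition sgexp (z : S) (m : nat) : S := iterop m *%g z z.

Definition monogenic (z : S) : set S := [set sgexp z m | m in [set m | 0 < m]].

Definition epg_adj : rel S :=
  fun x y => (x != y) && `[< exists z : S, monogenic z x /\ monogenic z y >].

Lemma epg_adj_sym : symmetric epg_adj.
Proof.
move=> x y; rewrite /epg_adj eq_sym; congr (_ && _).
by apply/asboolP/asboolP => -[z [zx zy]]; exists z.
Qed.

Lemma epg_adj_irr : irreflexive epg_adj.
Proof. by move=> x; rewrite /epg_adj eqxx. Qed.

Definition enhanced_power_graph : sgraph S := SGraph epg_adj_sym epg_adj_irr.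

End EnhancedPowerGraph.

(* Main.v *)
(* Having a common power is a transitive relation, and two powers z^a, z^b of
   one element have the common power z^(ab); hence it holds along every path.
   Conversely a common power w of x and y is adjacent or equal to each of them,
   so x, w, y contains a path of length at most 2. *)
Require Import Defs.
From mathcomp Require Import all_boot all_order all_algebra.
From mathcomp Require Import boolp classical_sets reals ereal.

Set Implicit Arguments.
Unset Strict Implicit.
Unset Printing Implicit Defensive.

Local Open Scope classical_set_scope.

Section Semigroup.
Variable S : semigroupType.
Implicit Types x y z w : S.

(** Positivity matters here: [sgexp z 0] is the default [z], so at [m = 0] the left side is [z] and
    the right side [z * z]. *)
Lemma sgexpS z m : 0 < m -> sgexp z m.+1 = (z * sgexp z m)%g.
Proof. by case: m. Qed.

Lemma sgexpD z m n :
  0 < m -> 0 < n -> sgexp z (m + n) = (sgexp z m * sgexp z n)%g.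
Proof.
(* Writing the exponent as a successor lets the induction start at exponent 1. *)
move=> m_gt0 n_gt0; case: m m_gt0 => // m _.
elim: m => [|m IHm]; first by rewrite add1n sgexpS.
by rewrite addSn sgexpS // IHm mulgA -sgexpS.
Qed.

Lemma sgexpM z m n : 0 < m -> 0 < n -> sgexp z (m * n) = sgexp (sgexp z m) n.
Proof.
move=> m_gt0; case: n => // n _.
elim: n => [|n IHn]; first by rewrite muln1.
by rewrite mulnS sgexpD ?muln_gt0 ?m_gt0 // IHn -sgexpS.
Qed.

Lemma monogenic_refl z : monogenic z z.
Proof. by exists 1. Qed.

Lemma monogenic_sgexp z m : 0 < m -> monogenic z (sgexp z m).
Proof. by move=> m_gt0; exists m. Qed.

Lemma monogenic_trans x y z : monogenic x y -> monogenic y z -> monogenic x z.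
Proof.
move=> [m /= m_gt0 <-] [n /= n_gt0 <-]; rewrite -sgexpM //.
by apply: monogenic_sgexp; rewrite muln_gt0 m_gt0.
Qed.

Lemma monogenic_meet z x y :
  monogenic z x -> monogenic z y -> monogenic x `&` monogenic y !=set0.
Proof.
move=> [m /= m_gt0 <-] [n /= n_gt0 <-]; exists (sgexp z (m * n)); split.
  by rewrite sgexpM //; apply: monogenic_sgexp.
by rewrite mulnC sgexpM //; apply: monogenic_sgexp.
Qed.

(** The two given common powers are both powers of [y], so they have a common power themselves. *)
Lemma meet_monogenic_trans y x z :
  monogenic x `&` monogenic y !=set0 -> monogenic y `&` monogenic z !=set0 ->
  monogenic x `&` monogenic z !=set0.
Proof.
move=> [u [xu yu]] [v [yv zv]]; have [w [uw vw]] := monogenic_meet yu yv.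
by exists w; split; [exact: monogenic_trans xu uw | exact: monogenic_trans zv vw].
Qed.

Lemma epg_path_meet x p :
  path (enhanced_power_graph S) x p ->
  monogenic x `&` monogenic (last x p) !=set0.
Proof.
elim: p x => [|y p IHp] x /=; first by exists x; split; exact: monogenic_refl.
case/andP=> /andP[_ /asboolP[z [zx zy]]] /IHp.
exact: meet_monogenic_trans (monogenic_meet zx zy).
Qed.

(** The vertex [x] itself serves as the generator. *)
Lemma epg_adj_monogenic x y : x != y -> monogenic x y -> epg_adj x y.
Proof.
move=> neq_xy xy; apply/andP; split=> //; apply/asboolP.
by exists x; split=> //; exact: monogenic_refl.
Qed.

(** Vertices of a path must be distinct, so the walk x, w, y shrinks to the empty path if x = y, and
    to a single edge if w is an endpoint. *)
Lemma meet_gpath x y :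
  monogenic x `&` monogenic y !=set0 ->
  exists2 p, gpath (enhanced_power_graph S) x y p & size p <= 2.
Proof.
move=> [w [xw yw]]; have [<-|neq_xy] := eqVneq x y.
  by exists [::]; rewrite // /gpath /= eqxx.
(* Kept conditional: it serves both the case w = x, where w != y follows from x != y, and the
   generic case. *)
have adj_wy : w != y -> epg_adj w y.
  by move=> neq_wy; rewrite epg_adj_sym epg_adj_monogenic // eq_sym.
have [eq_wx|neq_wx] := eqVneq w x.
  by exists [:: y]; rewrite // /gpath /= inE neq_xy eqxx -eq_wx adj_wy ?eq_wx.
have adj_xw : epg_adj x w by rewrite epg_adj_monogenic // eq_sym.
have [eq_wy|neq_wy] := eqVneq w y.
  by exists [:: y]; rewrite // /gpath /= inE neq_xy eqxx -eq_wy adj_xw.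
exists [:: w; y]; rewrite // /gpath /= !inE adj_xw adj_wy // eqxx negb_or.
by rewrite neq_xy neq_wy eq_sym neq_wx.
Qed.

Lemma gconnected_epgP :
  gconnected (enhanced_power_graph S) <->
  forall x y, monogenic x `&` monogenic y !=set0.
Proof.
split=> [conn x y | meet x y].
  by have [p /and3P[path_p /eqP <- _]] := conn x y; exact: epg_path_meet.
by have [p xy_p _] := meet_gpath (meet x y); exists p.
Qed.

End Semigroup.

(** A distance is an infimum, so the length of any one path bounds it; a bound uniform in the pair
    then bounds the supremum. *)
Lemma gdiam_le (R : realType) (V : eqType) (G : sgraph V) (n : nat) :
  (forall x y, exists2 p, gpath G x y p & size p <= n) ->
  (gdiam G R <= n%:R%:E)%E.
Proof.
move=> short; apply: ge_ereal_sup => _ [[x y] _ <-] /=.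
have [p xy_p le_p_n] := short x y.
apply: (@Order.POrderTheory.le_trans _ _ ((size p)%:R%:E)%E).
  by apply: ereal_inf_lbound; exists p.
by rewrite lee_fin Num.Theory.ler_nat.
Qed.

Theorem corollary3p2 (R : realType) (S : semigroupType) :
  (gconnected (enhanced_power_graph S) <->
     forall x y : S, monogenic x `&` monogenic y !=set0) /\
  (gconnected (enhanced_power_graph S) ->
     (gdiam (enhanced_power_graph S) R <= 2%:R%:E)%E).
Proof.
split; first exact: gconnected_epgP.
(* The paths given by connectedness may be long; they only supply common powers, which yield new
   paths with at most 2 edges. *)
by move=> /gconnected_epgP meet; apply: gdiam_le => x y; exact: meet_gpath.
Qed.
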